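(* Let $G$ be a finite graph. Every relation $R\subseteq V_G\times V_G$ satisfying $G\ast R=G$ is an automorphism of $G$ if and only if $G$ has property N.
   Context: Graphs are finite and undirected, loops allowed. For a finite set $B$ and a relation $R\subseteq V_G\times B$ with full image (every $b\in B$ has some $v\in V_G$ with $(v,b)\in R$), $G\ast R$ is the graph with vertex set $B$ and edge set $\{(a,b)\in B\times B: \exists (u,v)\in E_G,\ (u,a)\in R,\ (v,b)\in R\}$; the equation $G\ast R=G$ presupposes that $R$ has full image. A relation $R$ is called an automorphism of $G$ if $R=\{(x,f(x)): x\in V_G\}$ for a graph automorphism $f$ of $G$. $N_G(x)$ is the set of vertices adjacent to $x$. $G$ has property N if for all $x,y\in V_G$, $N_G(x)\subseteq N_G(y)$ implies $x=y$. *)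

(* Defs.v *)
From HB Require Import structures.
From mathcomp Require Import all_boot all_fingroup.

Set Implicit Arguments.
Unset Strict Implicit.
Unset Printing Implicit Defensive.

(* The symmetry of the edge set is a boolean condition, hence proof irrelevant:
   Leibniz equality of graphs on V is equality of edge sets (graph_inj).
   Loops, i.e. edges (x, x), are allowed. *)
Record graph (V : finType) := Graph {
  edges : {set V * V};
  edges_sym : [forall u : V, forall v : V,
                 ((u, v) \in edges) == ((v, u) \in edges)]
}.

Lemma graph_inj (V : finType) : injective (@edges V).
Proof.
move=> [E1 s1] [E2 s2] /= eqE; case: E2 / eqE s2 => s2.
by congr Graph; exact: bool_irrelevance.
Qed.

Lemma edgesC (V : finType) (G : graph V) (u v : V) :
  ((u, v) \in edges G) = ((v, u) \in edges G).
Proof. by have /forallP/(_ u)/forallP/(_ v)/eqP := edges_sym G. Qed.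

Definition neigh (V : finType) (G : graph V) (x : V) : {set V} :=
  [set y | (x, y) \in edges G].

Definition full_image (V B : finType) (R : {set V * B}) : Prop :=
  forall b : B, exists v : V, (v, b) \in R.

Definition star_edges (V B : finType) (G : graph V) (R : {set V * B}) :
    {set B * B} :=
  [set ab : B * B | [exists uv : V * V,
     [&& uv \in edges G, (uv.1, ab.1) \in R & (uv.2, ab.2) \in R]]].

Lemma star_edges_sym (V B : finType) (G : graph V) (R : {set V * B}) :
  [forall a : B, forall b : B,
     ((a, b) \in star_edges G R) == ((b, a) \in star_edges G R)].
Proof.
apply/forallP=> a; apply/forallP=> b; rewrite !inE /=; apply/eqP.
by apply/existsP/existsP=> -[[u v] /= /and3P[Euv Ru Rv]];
  exists (v, u); rewrite /= edgesC Euv Ru Rv.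
Qed.

(* G * R. The definition makes sense for every R, but the operation is only
   meant for R satisfying full_image. *)
Definition star (V B : finType) (G : graph V) (R : {set V * B}) : graph B :=
  Graph (star_edges_sym G R).

Definition is_graph_automorphism (V : finType) (G : graph V) (f : {perm V}) :
    Prop :=
  forall x y : V, ((f x, f y) \in edges G) = ((x, y) \in edges G).

Definition relation_automorphism (V : finType) (G : graph V)
    (R : {set V * V}) : Prop :=
  exists f : {perm V},
    is_graph_automorphism G f /\ R = [set (x, f x) | x : V].

Definition property_N (V : finType) (G : graph V) : Prop :=
  forall x y : V, neigh G x \subset neigh G y -> x = y.

(* Main.v *)
Require Import Defs.
From mathcomp Require Import all_boot all_fingroup.

(** If N(x) is contained in N(y) with x <> y, the identity relation enlarged by
    the pair (x, y) fixes G and is not functional. Conversely, if G * R = G then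
    G * R^n = G for all n; by finiteness R^(i + p) = R^i for some i and p > 0,
    and expressing the edges of G through R^i shows that every neighbourhood is
    closed under R^p. So (v, b) in R^p gives N(v) <= N(b), hence v = b under
    property N: R^p is the identity, and an invertible relation is a
    permutation. *)

Set Implicit Arguments.
Unset Strict Implicit.
Unset Printing Implicit Defensive.

Section RelationPowers.

Variable V : finType.
Implicit Types (R S T : {set V * V}) (m n : nat).

Definition rel_id : {set V * V} := [set xy | xy.1 == xy.2].

Definition rel_comp R S : {set V * V} :=
  [set xz | [exists y, ((xz.1, y) \in R) && ((y, xz.2) \in S)]].

(** The powers are the orbit of [rel_id] under a self-map of a finite type, the form in which
    [looping_order] yields a repetition. *)
Definition rel_pow R n : {set V * V} := iter n (rel_comp^~ R) rel_id.

Lemma in_rel_id x y : ((x, y) \in rel_id) = (x == y).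
Proof. by rewrite inE. Qed.

Lemma rel_compP R S x z :
  reflect (exists2 y, (x, y) \in R & (y, z) \in S) ((x, z) \in rel_comp R S).
Proof.
rewrite inE /=; apply: (iffP existsP) => [[y /andP[Rxy Syz]]|[y Rxy Syz]].
  by exists y.
by exists y; rewrite Rxy.
Qed.

Lemma rel_comp1r R : rel_comp rel_id R = R.
Proof.
apply/setP=> -[x z]; apply/rel_compP/idP => [[y]|Rxz].
  by rewrite in_rel_id => /eqP->.
by exists x; rewrite // in_rel_id.
Qed.

Lemma rel_compr1 R : rel_comp R rel_id = R.
Proof.
apply/setP=> -[x z]; apply/rel_compP/idP => [[y Rxy]|Rxz].
  by rewrite in_rel_id => /eqP<-.
by exists z; rewrite // in_rel_id.
Qed.

Lemma rel_compA R S T :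
  rel_comp R (rel_comp S T) = rel_comp (rel_comp R S) T.
Proof.
apply/setP=> -[x z]; apply/rel_compP/rel_compP.
  move=> [y Rxy /rel_compP[t Syt Ttz]].
  by exists t => //; apply/rel_compP; exists y.
move=> [t /rel_compP[y Rxy Syt] Ttz].
by exists y => //; apply/rel_compP; exists t.
Qed.

Lemma rel_powD R m n :
  rel_pow R (m + n) = rel_comp (rel_pow R m) (rel_pow R n).
Proof.
elim: n => [|n IHn]; first by rewrite addn0 rel_compr1.
by rewrite addnS /= -/(rel_pow R _) IHn -rel_compA.
Qed.

Lemma rel_powS R n : rel_pow R n.+1 = rel_comp R (rel_pow R n).
Proof. by rewrite -add1n rel_powD /= rel_comp1r. Qed.

Lemma rel_pow_periodic R :
  exists i p, rel_pow R (i + p.+1) = rel_pow R i.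
Proof.
have /trajectP[i lt_i_n eq_i_n] := looping_order (rel_comp^~ R) rel_id.
(* The period is positive because [i] lies strictly below the order, so it is a successor. *)
exists i, (fingraph.order (rel_comp^~ R) rel_id - i).-1.
by rewrite prednK ?subn_gt0 // subnKC // ltnW.
Qed.

Lemma full_image_pow R n : full_image R -> full_image (rel_pow R n).
Proof.
move=> fullR; elim: n => [|n IHn] z; first by exists z; rewrite in_rel_id.
have [y Ryz] := fullR z; have [x Rxy] := IHn y.
by exists x; apply/rel_compP; exists y.
Qed.

(** [rel_pow R n] is a two-sided inverse of [R]: composed before [R] it makes [R] single-valued,
    composed after [R] it makes [R] total and injective. *)
Lemma rel_pow_id_perm R n :
  rel_pow R n.+1 = rel_id -> exists f : {perm V}, R = [set (x, f x) | x : V].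
Proof.
move=> Rn1; have cancelR x y z : (y, x) \in rel_pow R n -> (x, z) \in R -> y = z.
  move=> Ryx Rxz; apply/eqP; rewrite -in_rel_id -Rn1 /=.
  by apply/rel_compP; exists x.
have /fin_all_exists2[f Rf fR] x :
    exists2 y, (x, y) \in R & (y, x) \in rel_pow R n.
  by apply/rel_compP; rewrite -rel_powS Rn1 in_rel_id.
have inj_f : injective f.
  move=> x y eq_fxy; have: (x, y) \in rel_pow R n.+1.
    by rewrite rel_powS; apply/rel_compP; exists (f x); rewrite // eq_fxy.
  by rewrite Rn1 in_rel_id => /eqP.
exists (perm inj_f); apply/setP=> -[x y]; apply/idP/imsetP.
  by move=> Rxy; exists x; rewrite // permE (cancelR _ _ _ (fR x) Rxy).
by move=> [z _ [-> ->]]; rewrite permE.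
Qed.

End RelationPowers.

Lemma starP (V B : finType) (G : graph V) (R : {set V * B}) a b :
  reflect (exists u v, [/\ (u, v) \in edges G, (u, a) \in R & (v, b) \in R])
          ((a, b) \in edges (star G R)).
Proof.
rewrite inE /=; apply: (iffP existsP).
  by move=> [[u v] /and3P[Guv Rua Rvb]]; exists u, v.
by move=> [u [v [Guv Rua Rvb]]]; exists (u, v); apply/and3P.
Qed.

Lemma star_id (V : finType) (G : graph V) : star G (rel_id V) = G.
Proof.
apply/graph_inj/setP=> -[a b]; apply/starP/idP.
  by move=> [u [v [Guv]]]; rewrite !in_rel_id => /eqP<- /eqP<-.
by move=> Gab; exists a, b; rewrite !in_rel_id.
Qed.

(** The intermediate points of the two composite pairs are the endpoints of an edge of [star G R].
    This action law lets every power of [R] fix [G] once [R] does. *)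
Lemma star_comp (V : finType) (G : graph V) (R S : {set V * V}) :
  star G (rel_comp R S) = star (star G R) S.
Proof.
apply/graph_inj/setP=> -[a b]; apply/starP/starP.
  move=> [u [v [Guv /rel_compP[s Rus Ssa] /rel_compP[t Rvt Stb]]]].
  by exists s, t; split=> //; apply/starP; exists u, v.
move=> [s [t [/starP[u [v [Guv Rus Rvt]]] Ssa Stb]]].
by exists u, v; split=> //; apply/rel_compP; [exists s | exists t].
Qed.

Lemma star_pow (V : finType) (G : graph V) (R : {set V * V}) n :
  star G R = G -> star G (rel_pow R n) = G.
Proof.
by move=> GR; elim: n => [|n IHn]; rewrite ?star_id //= star_comp IHn.
Qed.

Lemma star_perm_automorphism (V : finType) (G : graph V) (f : {perm V}) :
  star G [set (x, f x) | x : V] = G -> is_graph_automorphism G f.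
Proof.
move=> Gf x y; rewrite -{1}Gf; apply/starP/idP.
  move=> [u [v [Guv]]].
  (* Injectivity of [f] forces the source edge to be [(x, y)] itself. *)
  by move=> /imsetP[_ _ [<- /perm_inj->]] /imsetP[_ _ [<- /perm_inj->]].
by move=> Gxy; exists x, y; split=> //; apply: imset_f.
Qed.

Lemma neigh_star_periodic (V : finType) (G : graph V) (R : {set V * V}) i p :
  star G R = G -> rel_pow R (i + p) = rel_pow R i ->
  forall v b, (v, b) \in rel_pow R p -> neigh G v \subset neigh G b.
Proof.
move=> GR Rip v b Rvb; apply/subsetP=> x; rewrite !inE -{1}(star_pow i GR).
move=> /starP[w [u [Gwu Rwv Rux]]]; rewrite -(star_pow i GR).
apply/starP; exists w, u; split=> //.
(* Going from [w] to [v] by the power [i] and on to [b] by the power [p] is again a power [i] step,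
   so the edge [(w, u)] also produces [(b, x)]. *)
by rewrite -Rip rel_powD; apply/rel_compP; exists v.
Qed.

Lemma star_add_pair (V : finType) (G : graph V) x y :
  neigh G x \subset neigh G y -> star G ((x, y) |: rel_id V) = G.
Proof.
move=> /subsetP sxy.
(* Endpoints are moved one at a time, [edgesC] exchanging their roles; this also covers an edge with
   both endpoints moved, such as a loop at [x]. *)
have sE u v a : (u, a) \in (x, y) |: rel_id V ->
    (u, v) \in edges G -> (a, v) \in edges G.
  rewrite in_setU1 in_rel_id => /orP[/eqP[-> ->] Gxv|/eqP-> //].
  by have := sxy v; rewrite !inE; apply.
apply/graph_inj/setP=> -[a b]; apply/starP/idP.
  move=> [u [v [Guv Rua Rvb]]].
  by apply: (sE _ _ _ Rua); rewrite edgesC; apply: (sE _ _ _ Rvb); rewrite edgesC.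
by move=> Gab; exists a, b; rewrite !in_setU1 !in_rel_id !eqxx !orbT.
Qed.

Theorem theorem4p3p7 (V : finType) (G : graph V) :
  (forall R : {set V * V},
     full_image R -> star G R = G -> relation_automorphism G R)
  <-> property_N G.
Proof.
split=> [autG x y sxy | propN R fullR GR].
  have full : full_image ((x, y) |: rel_id V).
    by move=> b; exists b; rewrite in_setU1 in_rel_id eqxx orbT.
  have [f [_ Rf]] := autG _ full (star_add_pair sxy).
  have fE u v : (u, v) \in (x, y) |: rel_id V -> v = f u.
    by rewrite Rf => /imsetP[w _ [-> ->]].
  (* Both [(x, x)] and [(x, y)] lie in the graph of [f], so [x] and [y] both equal [f x]. *)
  by apply: (@etrans _ _ (f x)); [|apply/esym];
    apply: fE; rewrite in_setU1 ?in_rel_id eqxx ?orbT.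
have [i [p Rip]] := rel_pow_periodic R.
have Rp : rel_pow R p.+1 = rel_id V.
  have sub v b : (v, b) \in rel_pow R p.+1 -> v = b.
    by move=> /(neigh_star_periodic GR Rip)/propN.
  apply/setP=> -[v b]; rewrite in_rel_id; apply/idP/eqP=> [/sub //|<-].
  (* Full image supplies some predecessor of [v], and [sub] identifies it with [v], so the whole
     diagonal is reached. *)
  by have [u Ruv] := full_image_pow p.+1 fullR v; rewrite -{1}(sub _ _ Ruv).
have [f Rf] := rel_pow_id_perm Rp.
by exists f; split=> //; apply: star_perm_automorphism; rewrite -Rf.
Qed.
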